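(* Let $d\ge 1$ and let $\Omega = \prod_{i=0}^{d-1}[a_i,b_i]\subset\mathbb{R}^d$ with $a_i<b_i$. Let $\gamma\colon\mathbb{R}^d\times\mathbb{R}^d\to\mathbb{R}$ be a kernel (satisfying the standing assumptions in the context) which is translation and reflection invariant, i.e. $\gamma(c+R_i x, c+R_i y)=\gamma(x,y)$ for all $c,x,y\in\mathbb{R}^d$ and all $0\le i\le d$, where $R_i(x)=(x_0,\ldots,-x_i,\ldots,x_{d-1})$ for $0\le i<d$ and $R_d=\mathrm{Id}$. Let $h>0$ be a grid size and let $V_c^h=\operatorname{span}\{\varphi_k\colon 0\le k<\mathbf{L}^d\}$ be the multilinear finite element space on the regular grid of $\Omega$ with grid size $h$, with the basis functions $\varphi_k$ defined in the context. Then the stiffness matrix $A=(A_{kj})_{0\le k,j<\mathbf{L}^d}$, $$A_{kj}=\int_{\Omega\cup\Omega_I}\int_{\Omega\cup\Omega_I}(\varphi_k(y)-\varphi_k(x))(\varphi_j(y)-\varphi_j(x))\,\gamma(x,y)\,dy\,dx,$$ is $d$-level Toeplitz with each level symmetric; that is, there is a function $t\colon \prod_{i=0}^{d-1}\{0,\ldots,L_i-1\}\to\mathbb{R}$ such that $$A_{E^{\mathbf{L}}(\mathbf{i}),\,E^{\mathbf{L}}(\mathbf{j})}=t(|\mathbf{i}-\mathbf{j}|)\qquad\text{for all }\mathbf{i},\mathbf{j}\in\prod_{i=0}^{d-1}\{0,\ldots,L_i-1\},$$ where $|\mathbf{i}-\mathbf{j}|$ denotes the componentwise absolute value.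
   Context: Kernel. Throughout, a kernel is a (measurable) nonnegative symmetric function $\gamma\colon\mathbb{R}^d\times\mathbb{R}^d\to\mathbb{R}$, $\gamma(x,y)=\gamma(y,x)\ge 0$, for which there are constants $\gamma_0>0$ and $0<R<\infty$ such that for all $x\in\Omega$: $\gamma(x,y)\ge\gamma_0$ for all $y\in B_{R/2}(x)$, and $\gamma(x,y)=0$ for all $y\notin B_R(x)$, where $B_r(x)=\{y\in\mathbb{R}^d\colon \|x-y\|_2<r\}$. The interaction domain is $\Omega_I=\{y\in\mathbb{R}^d\setminus\Omega\colon \exists x\in\Omega,\ \gamma(x,y)\neq 0\}$. Energy space. $V_c(\Omega\cup\Omega_I)$ is the set of $u\in L^2(\Omega\cup\Omega_I)$ with $u=0$ a.e. on $\Omega_I$ and $\int_{\Omega\cup\Omega_I}\int_{\Omega\cup\Omega_I}(u(y)-u(x))^2\gamma(x,y)\,dy\,dx<\infty$. It is assumed that the finite element space $V_c^h$ defined below is a subspace of $V_c(\Omega\cup\Omega_I)$ (so that all entries $A_{kj}$ are finite, absolutely convergent integrals). Grid. The grid size $h>0$ is such that $N_i=(b_i-a_i)/h$ is an integer with $N_i\ge 2$ for each $0\le i<d$. Put $L_i=N_i-1$, $\mathbf{L}=(L_0,\ldots,L_{d-1})$, and $\mathbf{L}^d:=\prod_{i=0}^{d-1}L_i$ (the number of inner grid points). For $\mathbf{n}=(n_0,\ldots,n_{d-1})\in\mathbb{N}^d$ let $$E^{\mathbf{n}}\colon \prod_{i=0}^{d-1}\{0,\ldots,n_i-1\}\to\Big\{0,\ldots,\prod_{i=0}^{d-1}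 n_i-1\Big\},\qquad E^{\mathbf{n}}(z)=\sum_{i=0}^{d-1}z_i\prod_{j>i}n_j,$$ which is a bijection, with inverse denoted $E^{-\mathbf{n}}$. With $a=(a_0,\ldots,a_{d-1})$ and $e=(1,\ldots,1)\in\mathbb{R}^d$, the inner grid points are $x_k=a+h\,(E^{-\mathbf{L}}(k)+e)$ for $0\le k<\mathbf{L}^d$. Basis functions. Let $\square=[0,1]^d$ with vertices $v_k=E^{-(2,\ldots,2)}(k)\in\{0,1\}^d$, $0\le k<2^d$, and element basis functions $\psi_k\colon\square\to[0,1]$, $$\psi_k(x)=\Big(\prod_{0\le i<d,\ (v_k)_i=0}(1-x_i)\Big)\Big(\prod_{0\le i<d,\ (v_k)_i=1}x_i\Big).$$ The reference basis function $\varphi\colon\mathbb{R}^d\to[0,1]$ is $\varphi(x)=\psi_i(v_i+x)$ if $x\in\square-v_i$ for some $0\le i<2^d$, and $\varphi(x)=0$ otherwise (the values agree where the cubes $\square-v_i$ overlap, and these cubes cover $[-1,1]^d$). For $0\le k<\mathbf{L}^d$ define $\varphi_k\colon\Omega\cup\Omega_I\to[0,1]$ by $\varphi_k(x)=\varphi\big(h^{-1}(x-x_k)\big)$. *)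

(* Defs.v *)
From HB Require Import structures.
From mathcomp Require Import all_boot all_order all_algebra.
From mathcomp Require Import all_classical all_reals all_analysis.
From mathcomp Require Import measurable_realfun zify.
Set Implicit Arguments.
Unset Strict Implicit.
Unset Printing Implicit Defensive.
Import Order.TTheory GRing.Theory Num.Theory.
Import numFieldNormedType.Exports.
Local Open Scope classical_set_scope.
Local Open Scope ring_scope.

(* [d.-tuple _] carries the product sigma-algebra, i.e. the Borel sets of R^d;
   [measurableTypeR R] is R with the Borel sets generated by intervals, which is
   the type [lebesgue_measure] is declared on. *)
Notation euclid R d := (d.-tuple (measurableTypeR R)).

(* The library has Lebesgue measure on R only.  The measure on R^n.+1 is the
   product of Lebesgue measure on R and the measure on R^n, transported along
   (x, s) |-> x :: s. *)
Section lebesgue_step.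
Context (R : realType) (n : nat).

Definition tcons (p : measurableTypeR R * euclid R n) :
  euclid R n.+1 := [the n.+1.-tuple _ of p.1 :: p.2].

Lemma measurable_tcons : measurable_fun setT tcons.
Proof. exact: measurable_cons. Qed.

Variable mu : {sigma_finite_measure set (euclid R n) -> \bar R}.

Definition leb_step : set (euclid R n.+1) -> \bar R :=
  pushforward (lebesgue_measure \x mu)%E tcons.

Let pushed : {measure set (euclid R n.+1) -> \bar R} :=
  measure_function_pushforward__canonical__measure_function_Measure
    [the {measure set _ -> \bar R} of (@lebesgue_measure R \x mu)%E] measurable_tcons.

HB.instance Definition _ := isMeasure.Build _ _ _ leb_step
  (measure0 pushed) (measure_ge0 pushed) (@measure_semi_sigma_additive _ _ _ pushed).

Lemma leb_stepE (A : set (measurableTypeR R))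
    (B : set (euclid R n)) :
  measurable A -> measurable B ->
  leb_step [set t | A (thead t) /\ B [tuple of behead t]]
    = (lebesgue_measure A * mu B)%E.
Proof.
move=> mA mB; rewrite /leb_step /pushforward.
rewrite (_ : _ @^-1` _ = A `*` B) ?product_measure1E//.
apply/seteqP; split => -[x s] /=.
  by move=> [Ax Bs]; split=> //=; rewrite (_ : s = [tuple of behead (tcons (x, s))])//;
    apply/val_inj.
by move=> [Ax Bs]; split=> //=; rewrite (_ : [tuple of _] = s)//; apply/val_inj.
Qed.

Lemma measurable_rect (A : set (measurableTypeR R))
    (B : set (euclid R n)) :
  measurable A -> measurable B ->
  measurable [set t : euclid R n.+1 |
    A (thead t) /\ B [tuple of behead t]].
Proof.
move=> mA mB; apply: measurableI.
  by rewrite -[X in measurable X]setTI; exact: measurable_tnth.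
by rewrite -[X in measurable X]setTI; exact: measurable_behead.
Qed.

Let leb_step_sigma_finite : sigma_finite setT leb_step.
Proof.
have /sigma_finiteP[F [TF ndF Foo]] := sigma_finiteT (@lebesgue_measure R).
have /sigma_finiteP[G [TG ndG Goo]] := sigma_finiteT mu.
exists (fun k => [set t | F k (thead t) /\ G k [tuple of behead t]]).
  apply/seteqP; split => // t _.
  have [i _ Fi] : (\bigcup_i F i) (thead t) by rewrite -TF.
  have [j _ Gj] : (\bigcup_i G i) [tuple of behead t] by rewrite -TG.
  exists (maxn i j) => //; split.
    by move: Fi; exact/subsetPset/ndF/leq_maxl.
  by move: Gj; exact/subsetPset/ndG/leq_maxr.
move=> k; have [? ?] := Foo k; have [? ?] := Goo k; split.
  exact: measurable_rect.
by rewrite leb_stepE// lte_mul_pinfty// ge0_fin_numE.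
Qed.

HB.instance Definition _ := Measure_isSigmaFinite.Build _ _ _ leb_step
  leb_step_sigma_finite.

End lebesgue_step.

Fixpoint leb (R : realType) (n : nat) :
    {sigma_finite_measure set (euclid R n) -> \bar R} :=
  match n with
  | 0 => \d_([tuple] : euclid R 0)
  | m.+1 => leb_step (leb R m)
  end.

Definition pcoord (R : realType) (d : nat) (x : euclid R d) (i : 'I_d) : R :=
  tnth x i.

Definition mkpoint (R : realType) (d : nat) (f : 'I_d -> R) : euclid R d :=
  [tuple f i | i < d].

Lemma pcoord_mkpoint (R : realType) (d : nat) (f : 'I_d -> R) (i : 'I_d) :
  pcoord (mkpoint f) i = f i.
Proof. by rewrite /pcoord tnth_mktuple. Qed.

Definition closed_box (R : realType) (d : nat) (a b : euclid R d) : set (euclid R d) :=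
  [set x | forall i, pcoord a i <= pcoord x i <= pcoord b i].

Lemma boxS (R : realType) (d : nat) (a b : euclid R d.+1) :
  closed_box a b = [set t | [set` `[thead a, thead b]] (thead t) /\
    closed_box [tuple of behead a] [tuple of behead b] [tuple of behead t]].
Proof.
have E (x : euclid R d.+1) i : pcoord x (lift ord0 i) = pcoord [tuple of behead x] i.
  by rewrite /pcoord tnth_behead; congr tnth; apply/val_inj; rewrite /= inordK// ltnS.
apply/seteqP; split => [x ax|x /= [x0 xS] i]; last first.
  case: (unliftP ord0 i) => [j ->|->]; first by rewrite !E.
  by move: x0; rewrite in_itv.
split; first by move: (ax ord0); rewrite /= in_itv.
by move=> i; rewrite -!E.
Qed.

(* [leb] has the defining property of Lebesgue measure on R^d. *)
Lemma leb_box (R : realType) (d : nat) (a b : euclid R d) :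
  (forall i, pcoord a i <= pcoord b i) ->
  measurable (closed_box a b) /\
  leb R d (closed_box a b) = (\prod_(i < d) (pcoord b i - pcoord a i))%:E.
Proof.
elim: d a b => [|d IH] a b ab.
  have -> : closed_box a b = setT by apply/seteqP; split => // x _ [].
  by split=> //; rewrite big_ord0/= diracT.
have E (x : euclid R d.+1) i : pcoord x (lift ord0 i) = pcoord [tuple of behead x] i.
  by rewrite /pcoord tnth_behead; congr tnth; apply/val_inj; rewrite /= inordK// ltnS.
have [i|mB vB] := IH [tuple of behead a] [tuple of behead b].
  by rewrite -!E.
have mI : @measurable _ (measurableTypeR R) [set` `[thead a, thead b]] by exact: measurable_itv.
rewrite boxS; split; first exact: measurable_rect.
rewrite [LHS](leb_stepE (leb R d) mI mB) vB lebesgue_measure_itv/= lte_fin big_ord_recl EFinM.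
congr (_ * _)%E; last by congr EFin; apply: eq_bigr => i _; rewrite !E.
have := ab ord0; rewrite le_eqVlt /pcoord => /orP[/eqP E0|lt0].
  by rewrite [thead a]E0 ltxx [tnth a _]E0 subrr.
by rewrite lt0.
Qed.

(* The measure [leb] lives on the Borel sets.  Lebesgue measurability is
   membership in the completion, [completed_algebra_gen].  Library integrals
   are suprema over simple Borel functions below the integrand (applied to its
   positive and negative parts), so on Lebesgue measurable integrands they
   agree with the integral against the completed measure.

   [measurable_fun D f] of the library is not used for this: it holds
   vacuously when D is not a Borel set. *)
Definition lebesgue_measurable_fun (dsp : measure_display)
    (T : measurableType dsp) (R : realType) (mu : set T -> \bar R) (D : set T)
    (f : T -> R) : Prop :=
  forall Y : set (measurableTypeR R), measurable Y ->
    completed_algebra_gen mu (D `&` f @^-1` Y).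

Definition vadd (R : realType) (d : nat) (x y : euclid R d) : euclid R d :=
  mkpoint (fun i => pcoord x i + pcoord y i).

Definition vsub (R : realType) (d : nat) (x y : euclid R d) : euclid R d :=
  mkpoint (fun i => pcoord x i - pcoord y i).

Definition vscale (R : realType) (d : nat) (c : R) (x : euclid R d) : euclid R d :=
  mkpoint (fun i => c * pcoord x i).

Definition norm2 (R : realType) (d : nat) (x : euclid R d) : R :=
  Num.sqrt (\sum_(i < d) pcoord x i ^+ 2).

Definition eball (R : realType) (d : nat) (x : euclid R d) (r : R) :
    set (euclid R d) := [set y | norm2 (vsub x y) < r].

Definition is_kernel (R : realType) (d : nat) (Omega : set (euclid R d))
    (gamma : euclid R d -> euclid R d -> R) : Prop :=
  [/\ lebesgue_measurable_fun (leb R d \x leb R d)%E setT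
        (fun p => gamma p.1 p.2),
      forall x y, gamma x y = gamma y x,
      forall x y, 0 <= gamma x y &
      exists gamma0 radius : R,
        [/\ 0 < gamma0, 0 < radius &
            forall x, Omega x ->
              (forall y, eball x (radius / 2) y -> gamma0 <= gamma x y) /\
              (forall y, ~ eball x radius y -> gamma x y = 0)]].

Definition interaction_domain (R : realType) (d : nat) (Omega : set (euclid R d))
    (gamma : euclid R d -> euclid R d -> R) : set (euclid R d) :=
  [set y | ~ Omega y /\ exists x, Omega x /\ gamma x y <> 0].

(* For i < d this negates coordinate i; for i = d no j satisfies the test, so
   it is the identity. *)
Definition reflect_coord (R : realType) (d : nat) (i : 'I_d.+1)
    (x : euclid R d) : euclid R d :=
  mkpoint (fun j => if (j : nat) == i then - pcoord x j else pcoord x j).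

Definition translation_reflection_invariant (R : realType) (d : nat)
    (gamma : euclid R d -> euclid R d -> R) : Prop :=
  forall (c x y : euclid R d) (i : 'I_d.+1),
    gamma (vadd c (reflect_coord i x)) (vadd c (reflect_coord i y)) = gamma x y.

Definition energy_space (R : realType) (d : nat) (Omega : set (euclid R d))
    (gamma : euclid R d -> euclid R d -> R) : set (euclid R d -> R) :=
  let OmegaI := interaction_domain Omega gamma in
  let D := Omega `|` OmegaI in
  [set u | [/\ lebesgue_measurable_fun (leb R d) D u,
      (\int[leb R d]_(x in D) (u x ^+ 2)%:E < +oo)%E,
      {ae leb R d, forall x, OmegaI x -> u x = 0} &
      (\int[leb R d]_(x in D) \int[leb R d]_(y in D)
         ((u y - u x) ^+ 2 * gamma x y)%:E < +oo)%E]].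

Definition multi_index (d : nat) (n : 'I_d -> nat) : Type :=
  {dffun forall i : 'I_d, 'I_(n i)}.

Definition encode_nat (d : nat) (n z : 'I_d -> nat) : nat :=
  (\sum_(i < d) z i * \prod_(j < d | i < j) n j)%N.

Lemma encode_natS (d : nat) (n z : 'I_d.+1 -> nat) :
  encode_nat n z = (z ord0 * (\prod_(j < d) n (lift ord0 j)) +
    encode_nat (fun i => n (lift ord0 i)) (fun i => z (lift ord0 i)))%N.
Proof.
rewrite /encode_nat big_ord_recl; congr (_ * _ + _)%N.
  by rewrite big_mkcond big_ord_recl/= mul1n; apply: eq_bigr.
apply: eq_bigr => i _; congr (_ * _)%N.
rewrite big_mkcond big_ord_recl/= mul1n [RHS]big_mkcond; apply: eq_bigr => j _.
by rewrite /bump !add1n ltnS.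
Qed.

Lemma encode_nat_lt (d : nat) (n z : 'I_d -> nat) :
  (forall i, z i < n i)%N -> (encode_nat n z < \prod_(i < d) n i)%N.
Proof.
elim: d n z => [|d IH] n z zn; first by rewrite /encode_nat !big_ord0.
rewrite encode_natS big_ord_recl.
apply: (@leq_trans ((z ord0).+1 * \prod_(j < d) n (lift ord0 j))%N).
  by rewrite mulSn addnC ltn_add2r IH.
by rewrite leq_mul2r zn orbT.
Qed.

Lemma encode_nat_inj (d : nat) (n z w : 'I_d -> nat) :
  (forall i, z i < n i)%N -> (forall i, w i < n i)%N ->
  encode_nat n z = encode_nat n w -> z =1 w.
Proof.
elim: d n z w => [|d IH] n z w zn wn; first by move=> _ [].
have zl := @encode_nat_lt d _ (fun i => z (lift ord0 i)) (fun i => zn _).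
have wl := @encode_nat_lt d _ (fun i => w (lift ord0 i)) (fun i => wn _).
rewrite !encode_natS => E.
have P0 : (0 < \prod_(j < d) n (lift ord0 j))%N by exact: leq_ltn_trans zl.
have E0 : z ord0 = w ord0.
  have := congr1 (divn^~ (\prod_(j < d) n (lift ord0 j))%N) E.
  by rewrite !divnMDl// !divn_small// !addn0.
move: E; rewrite E0 => /addnI E i.
by case: (unliftP ord0 i) => [j ->|->//]; exact: (IH _ _ _ _ _ E).
Qed.

Definition mi_encode (d : nat) (n : 'I_d -> nat) (z : multi_index n) :
    'I_(\prod_(i < d) n i) :=
  Ordinal (@encode_nat_lt d n (fun i => z i) (fun i => ltn_ord (z i))).

Lemma encode_inj (d : nat) (n : 'I_d -> nat) : injective (@mi_encode d n).
Proof.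
move=> z w /(congr1 val)/= E; apply/ffunP => i; apply/val_inj.
exact: (encode_nat_inj (fun i => ltn_ord (z i)) (fun i => ltn_ord (w i)) E).
Qed.

Lemma encode_codom (d : nat) (n : 'I_d -> nat) (k : 'I_(\prod_(i < d) n i)) :
  k \in codom (@mi_encode d n).
Proof.
apply: inj_card_onto; first exact: encode_inj.
rewrite card_ord card_dep_ffun foldrE big_map big_enum /=.
by apply: eq_leq; apply: eq_bigr => i _; rewrite card_ord.
Qed.

Definition mi_decode (d : nat) (n : 'I_d -> nat) (k : 'I_(\prod_(i < d) n i)) :
    multi_index n := iinv (encode_codom k).

Lemma decodeK (d : nat) (n : 'I_d -> nat) : cancel (@mi_decode d n) (@mi_encode d n).
Proof. by move=> k; exact: f_iinv. Qed.

Lemma encodeK (d : nat) (n : 'I_d -> nat) : cancel (@mi_encode d n) (@mi_decode d n).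
Proof. by move=> z; apply: encode_inj; rewrite decodeK. Qed.

Lemma absdiff_subproof (n : nat) (i j : 'I_n) : (`|(i : int) - (j : int)| < n)%N.
Proof. by have := ltn_ord i; have := ltn_ord j; lia. Qed.

Definition absdiff (d : nat) (n : 'I_d -> nat) (i j : multi_index n) :
    multi_index n :=
  [ffun m => Ordinal (absdiff_subproof (i m) (j m))].

Definition vertex_index (d : nat) : Type := 'I_(\prod_(i < d) 2).

Definition vertex_bit (d : nat) (k : vertex_index d) (i : 'I_d) : nat :=
  @mi_decode d (fun=> 2%N) k i.

Definition vertex (R : realType) (d : nat) (k : vertex_index d) : euclid R d :=
  mkpoint (fun i => (vertex_bit k i)%:R).

Definition in_unit_cube (R : realType) (d : nat) (x : euclid R d) : bool :=
  [forall i, 0 <= pcoord x i <= 1].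

Definition element_basis (R : realType) (d : nat) (k : vertex_index d)
    (x : euclid R d) : R :=
  (\prod_(i < d | vertex_bit k i == 0%N) (1 - pcoord x i)) *
  (\prod_(i < d | vertex_bit k i == 1%N) pcoord x i).

Definition reference_basis (R : realType) (d : nat) (x : euclid R d) : R :=
  if [pick k : 'I_(\prod_(i < d) 2) | in_unit_cube (vadd (vertex R k) x)] is Some k
  then element_basis k (vadd (vertex R k) x) else 0.

(* The choice made by [pick] is irrelevant: the element basis functions agree
   where the translated cubes overlap. *)
Lemma element_basisE (R : realType) (d : nat) (k : vertex_index d) (x : euclid R d) :
  in_unit_cube (vadd (vertex R k) x) ->
  element_basis k (vadd (vertex R k) x) = \prod_(i < d) (1 - `|pcoord x i|).
Proof.
move=> /forallP cube; rewrite /element_basis.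
rewrite (big_mkcond (fun i => vertex_bit k i == 0%N)).
rewrite (big_mkcond (fun i => vertex_bit k i == 1%N)) -big_split/=.
apply: eq_bigr => i _; have := cube i; rewrite !pcoord_mkpoint.
have : (vertex_bit k i < 2)%N by exact: ltn_ord.
case: (vertex_bit k i) => [|[|//]] _ /=; rewrite ?add0r ?mul1r ?mulr1.
  by move=> /andP[x0 _]; rewrite ger0_norm.
by rewrite -subr_ge0 => /andP[_]; rewrite gerDl => x0; rewrite ler0_norm// opprK.
Qed.

Lemma reference_basisE (R : realType) (d : nat) (k : vertex_index d)
    (x : euclid R d) :
  in_unit_cube (vadd (vertex R k) x) ->
  reference_basis x = element_basis k (vadd (vertex R k) x).
Proof.
move=> cube; rewrite /reference_basis; case: pickP => [l cube'|/(_ k)].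
  by rewrite !element_basisE.
by rewrite cube.
Qed.

Definition grid_point (R : realType) (d : nat) (a : euclid R d) (h : R)
    (L : 'I_d -> nat) (k : 'I_(\prod_(i < d) L i)) : euclid R d :=
  mkpoint (fun i => pcoord a i + h * ((mi_decode k i)%:R + 1)).

(* Defined on all of R^d; only its values on the union of Omega and the
   interaction domain enter below. *)
Definition grid_basis (R : realType) (d : nat) (a : euclid R d) (h : R)
    (L : 'I_d -> nat) (k : 'I_(\prod_(i < d) L i)) (x : euclid R d) : R :=
  reference_basis (vscale h^-1 (vsub x (grid_point a h k))).

Definition fe_space (R : realType) (d : nat) (a : euclid R d) (h : R)
    (L : 'I_d -> nat) : set (euclid R d -> R) :=
  [set u | exists c : 'I_(\prod_(i < d) L i) -> R,
     u = fun x => \sum_k c k * grid_basis a h k x].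

Definition stiffness (R : realType) (d : nat) (Omega : set (euclid R d))
    (gamma : euclid R d -> euclid R d -> R) (a : euclid R d) (h : R)
    (L : 'I_d -> nat) : 'M[R]_(\prod_(i < d) L i) :=
  let D := Omega `|` interaction_domain Omega gamma in
  \matrix_(k, j) fine (\int[leb R d]_(x in D) \int[leb R d]_(y in D)
    ((grid_basis a h k y - grid_basis a h k x) *
     (grid_basis a h j y - grid_basis a h j x) * gamma x y)%:E)%E.

Definition multilevel_symmetric_toeplitz (R : realType) (d : nat)
    (L : 'I_d -> nat) (A : 'M[R]_(\prod_(i < d) L i)) : Prop :=
  exists t : multi_index L -> R,
    forall i j : multi_index L, A (mi_encode i) (mi_encode j) = t (absdiff i j).

(* Main.v *)
Require Import Defs.
From HB Require Import structures.
From mathcomp Require Import all_boot all_order all_algebra.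
From mathcomp Require Import all_classical all_reals all_analysis.
From mathcomp Require Import measurable_realfun ring lra zify.
Set Implicit Arguments.
Unset Strict Implicit.
Unset Printing Implicit Defensive.
Import Order.TTheory GRing.Theory Num.Theory.
Import numFieldNormedType.Exports.
Local Open Scope classical_set_scope.
Local Open Scope ring_scope.

(* The integrand of A_kj vanishes off D x D, where D is the union of Omega and
   its interaction domain, so both integrals may be taken over R^d.  Given
   multi-indices i and j, the map T sending each coordinate x_m to c_m + x_m or
   c_m - x_m, with the minus sign where i_m < j_m and c chosen so that T maps the
   grid point of index 0 to that of index j, also maps the grid point of index
   |i - j| to that of index i.  Since the reference basis function is even in
   each coordinate, and T preserves gamma and Lebesgue measure, substituting T in
   both variables turns A_ij into A_{|i-j|,0}.  As gamma and D need not be Borel,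
   the substitution rule is needed for arbitrary integrands. *)

(** * Change of variables for arbitrary integrands *)

Section nnsfun_composition.
Context d1 d2 (X : measurableType d1) (Y : measurableType d2) (R : realType).
Variables (T : X -> Y) (mT : measurable_fun setT T).

Import HBSimple HBNNSimple.

Variable g : {nnsfun Y >-> R}.

(* The measurability proof is an argument so that it can be recovered by the
   canonical structure instances below. *)
Definition nnsfun_comp of measurable_fun setT T : X -> R := g \o T.

Lemma finite_range_nnsfun_comp : finite_set (range (nnsfun_comp mT)).
Proof.
by apply: sub_finite_set (@fimfunP _ _ g) => _ [x _ <-]; exists (T x).
Qed.

HB.instance Definition _ := @isMeasurableFun.Build _ _ _ _ (nnsfun_comp mT)
  (measurableT_comp (@measurable_funPT _ _ _ _ g) mT).

HB.instance Definition _ := @isNonNegFun.Build X R (nnsfun_comp mT)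
  (fun x => @fun_ge0 Y R g (T x)).

HB.instance Definition _ := FiniteImage.Build X R (nnsfun_comp mT)
  finite_range_nnsfun_comp.

Definition nnsfun_comp_nnsfun : {nnsfun X >-> R} := nnsfun_comp mT.

End nnsfun_composition.

Section integral_comp_le.
Import HBSimple HBNNSimple.

(** A simple [g] below [f] pulls back to the simple function [g \o T] below [f \o T], with the same
    integral because [T] carries [mu] to [nu]. *)
Lemma integral_comp_le d1 d2 (X : measurableType d1) (Y : measurableType d2)
    (R : realType) (mu : {measure set X -> \bar R}) (nu : {measure set Y -> \bar R})
    (T : X -> Y) (mT : measurable_fun setT T)
    (Tmu : forall A, measurable A -> mu (T @^-1` A) = nu A) (f : Y -> \bar R) :
  (forall y, 0 <= f y)%E -> (\int[nu]_y f y <= \int[mu]_x f (T x))%E.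
Proof.
move=> f0; rewrite !ge0_integralTE//.
apply: ereal_sup_le => _ [g gf <-].
exists (nnsfun_comp_nnsfun mT g) => [x|]; first exact: gf.
rewrite /sintegral; apply: eq_fsbigr => r _; congr (_ * _)%E.
by rewrite -Tmu//; exact: measurable_funPTI.
Qed.

End integral_comp_le.

(* No measurability of [f] is needed: the integral of a non-negative function
   is a supremum over simple functions, and composition with [T] is a bijection
   between the simple functions below [f] and those below [f \o T]. *)
Lemma integral_comp_iso d1 d2 (X : measurableType d1) (Y : measurableType d2)
    (R : realType) (mu : {measure set X -> \bar R}) (nu : {measure set Y -> \bar R})
    (T : X -> Y) (S : Y -> X) (mT : measurable_fun setT T)
    (mS : measurable_fun setT S) (TK : cancel T S) (SK : cancel S T)
    (Tmu : forall A, measurable A -> mu (T @^-1` A) = nu A) (f : Y -> \bar R) :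
  (\int[mu]_x f (T x) = \int[nu]_y f y)%E.
Proof.
have ge0 (g : Y -> \bar R) : (forall y, 0 <= g y)%E ->
    (\int[mu]_x g (T x) = \int[nu]_y g y)%E.
  move=> g0; apply/eqP; rewrite eq_le (integral_comp_le mT Tmu g0) andbT.
  have Snu A : measurable A -> nu (S @^-1` A) = mu A.
    move=> mA; rewrite -Tmu; first by rewrite -comp_preimage (_ : S \o T = id)//; apply/funext.
    by rewrite -[X in measurable X]setTI; exact: mS.
  (* Applied to [S] and [g \o T], the inequality reverses, since [T] undoes [S]. *)
  have := integral_comp_le mS Snu (fun x => g0 (T x)).
  by under [X in (_ <= X)%E -> _]eq_integral do rewrite SK.
rewrite integralE [RHS]integralE -(ge0 f^\+)%E// -(ge0 f^\-)%E//; congr (_ - _)%E;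
  by apply: eq_integral => x _; rewrite !(funeposE, funenegE).
Qed.

(** * Signed coordinate shifts: invariance of Lebesgue measure and of the kernel *)

Definition signed_shift (R : realType) (s : bool) (c x : R) : R := c + (-1) ^+ s * x.

Lemma measurable_signed_shift (R : realType) (s : bool) (c : R) :
  measurable_fun setT
    (signed_shift s c : measurableTypeR R -> measurableTypeR R).
Proof. by apply: measurable_funD => //; apply: measurable_funM. Qed.

(** The image measure gives half-open intervals their length, and this determines Lebesgue
    measure. *)
Lemma lebesgue_measure_signed_shift (R : realType) (s : bool) (c : R)
    (A : set (measurableTypeR R)) : measurable A ->
  lebesgue_measure (signed_shift s c @^-1` A) = lebesgue_measure A.
Proof.
move=> mA.
have /(_ _ _ mA) := @lebesgue_measure_unique R
   (measure_function_pushforward__canonical__measure_function_Measure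
    [the {measure set _ -> \bar R} of @lebesgue_measure R]
    (measurable_signed_shift s c)).
move=> -> // _ [[x y] _ <-] /=.
rewrite /pushforward.
(* A flip moves the closed end to the other side, which leaves the length unchanged. *)
rewrite (_ : _ @^-1` _ = [set` if s then `[c - y, c - x[ else `]x - c, y - c]]); last first.
  apply/seteqP; rewrite /signed_shift; case: s; split => z /=; rewrite !in_itv/= ?expr1 ?expr0; lra.
rewrite !lebesgue_measure_itv; case: s => /=; rewrite !lte_fin.
  rewrite (_ : (c - y < c - x) = (x < y)); last by apply/idP/idP; lra.
  by case: ifP => // _; rewrite -!EFinB; congr EFin; lra.
rewrite (_ : (x - c < y - c) = (x < y)); last by apply/idP/idP; lra.
by case: ifP => // _; rewrite -!EFinB; congr EFin; lra.
Qed.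

Lemma signed_shiftK (R : realType) (s : bool) (c : R) :
  cancel (signed_shift s c) (signed_shift s (- ((-1) ^+ s * c))).
Proof. by move=> x; rewrite /signed_shift; case: s; rewrite ?expr1 ?expr0; lra. Qed.

Lemma signed_shiftVK (R : realType) (s : bool) (c : R) :
  cancel (signed_shift s (- ((-1) ^+ s * c))) (signed_shift s c).
Proof. by move=> x; rewrite /signed_shift; case: s; rewrite ?expr1 ?expr0; lra. Qed.

Definition axis_isometry (R : realType) (d : nat) (s : 'I_d -> bool) (c : euclid R d)
    (x : euclid R d) : euclid R d :=
  mkpoint (fun i => signed_shift (s i) (pcoord c i) (pcoord x i)).

(** A sign is its own inverse, so solving y = c + (-1)^s x for x gives a signed shift with the same
    s. *)
Definition axis_isometry_inv (R : realType) (d : nat) (s : 'I_d -> bool) (c : euclid R d) :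
    euclid R d -> euclid R d :=
  axis_isometry s (mkpoint (fun i => - ((-1) ^+ s i * pcoord c i))).

Lemma pcoordP (R : realType) (d : nat) (x y : euclid R d) :
  pcoord x =1 pcoord y -> x = y.
Proof. by move=> xy; apply: eq_from_tnth. Qed.

Lemma axis_isometryK (R : realType) (d : nat) (s : 'I_d -> bool) (c : euclid R d) :
  cancel (axis_isometry s c) (axis_isometry_inv s c).
Proof. by move=> x; apply: pcoordP => i; rewrite !pcoord_mkpoint signed_shiftK. Qed.

Lemma axis_isometryVK (R : realType) (d : nat) (s : 'I_d -> bool) (c : euclid R d) :
  cancel (axis_isometry_inv s c) (axis_isometry s c).
Proof. by move=> x; apply: pcoordP => i; rewrite !pcoord_mkpoint signed_shiftVK. Qed.

Lemma measurable_axis_isometry (R : realType) (d : nat) (s : 'I_d -> bool) (c : euclid R d) :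
  measurable_fun setT (axis_isometry s c).
Proof.
apply/measurable_fun_tnthP => i.
rewrite (_ : _ \o _ = signed_shift (s i) (pcoord c i) \o (@tnth _ _ ^~ i)).
  by apply: measurableT_comp (measurable_signed_shift _ _) _; exact: measurable_tnth.
by apply/funext => x /=; rewrite /axis_isometry /mkpoint tnth_mktuple.
Qed.

Lemma axis_isometry_tcons (R : realType) (d : nat) (s : 'I_d.+1 -> bool)
    (c : euclid R d.+1) (x : R) (y : euclid R d) :
  axis_isometry s c (tcons (x, y)) =
  tcons (signed_shift (s ord0) (pcoord c ord0) x,
         axis_isometry (fun i => s (lift ord0 i))
           (mkpoint (fun i => pcoord c (lift ord0 i))) y).
Proof.
apply: pcoordP => i; case: (unliftP ord0 i) => [j|] ->;
  rewrite pcoord_mkpoint /pcoord /tcons ?tnthS ?tnth0 ?tnth_mktuple//.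
by rewrite -/(pcoord _ _) pcoord_mkpoint.
Qed.

(** Induction on [d] through sections: the induction hypothesis treats the measure of each section,
    the one-dimensional case the integral over the first coordinate. *)
Lemma leb_axis_isometry (R : realType) (d : nat) (s : 'I_d -> bool) (c : euclid R d)
    (A : set (euclid R d)) : measurable A ->
  leb R d (axis_isometry s c @^-1` A) = leb R d A.
Proof.
elim: d s c A => [|d IH] s c A mA.
  rewrite (_ : axis_isometry s c = id)//; apply/funext => x.
  by apply: pcoordP => -[].
have mB : measurable (@tcons R d @^-1` A).
  by rewrite -[X in measurable X]setTI; exact: measurable_tcons.
rewrite /= /leb_step /pushforward /product_measure1.
set B := (@tcons R d) @^-1` A.
set T := signed_shift (s ord0) (pcoord c ord0).
rewrite -[RHS](integral_comp_iso (mu := @lebesgue_measure R)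
   (measurable_signed_shift (s ord0) (pcoord c ord0)) (measurable_signed_shift (s ord0) _)
   (@signed_shiftK _ _ _) (@signed_shiftVK _ _ _)); last first.
  by move=> X mX; exact: lebesgue_measure_signed_shift.
apply: eq_integral => x _ /=.
set S := axis_isometry (fun i => s (lift ord0 i))
  (mkpoint (fun i => pcoord c (lift ord0 i))).
rewrite (_ : xsection _ x = S @^-1` xsection B (T x)).
  by apply: IH; exact: measurable_xsection.
by apply/seteqP; split => y; rewrite /preimage/= !xsectionE /preimage/= axis_isometry_tcons.
Qed.

Lemma integral_axis_isometry (R : realType) (d : nat) (s : 'I_d -> bool) (c : euclid R d)
    (f : euclid R d -> \bar R) :
  (\int[leb R d]_x f (axis_isometry s c x) = \int[leb R d]_x f x)%E.
Proof.
apply: (integral_comp_iso _ _ (@axis_isometryK _ _ s c) (@axis_isometryVK _ _ s c)) => [||A mA].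
- exact: measurable_axis_isometry.
- exact: measurable_axis_isometry.
- exact: leb_axis_isometry.
Qed.

Lemma gamma_axis_isometry (R : realType) (d : nat) (gamma : euclid R d -> euclid R d -> R)
    (s : 'I_d -> bool) (c x y : euclid R d) :
  translation_reflection_invariant gamma ->
  gamma (axis_isometry s c x) (axis_isometry s c y) = gamma x y.
Proof.
(* The invariance hypothesis flips one coordinate at a time, hence the induction
   on the number of leading coordinates that may be flipped. *)
move=> hinv; pose trunc k (i : 'I_d) := s i && (i < k)%N.
have -> : s = trunc d by apply/funext => i; rewrite /trunc ltn_ord andbT.
have reflect_inv i z w : gamma (reflect_coord i z) (reflect_coord i w) = gamma z w.
  have vadd0 t : vadd (mkpoint (fun=> 0)) t = t.
    by apply: pcoordP => j; rewrite !pcoord_mkpoint add0r.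
  by rewrite -[RHS](hinv (mkpoint (fun=> 0)) _ _ i) !vadd0.
set n := (X in trunc X); move: n x y; elim=> [|k IH] x y.
  (* Without flips only a translation remains; at [ord_max] the reflection is the identity. *)
  have E z : axis_isometry (trunc 0) c z = vadd c (reflect_coord ord_max z).
    apply: pcoordP => j; rewrite !pcoord_mkpoint /trunc ltn0 andbF.
    by rewrite /signed_shift expr0 mul1r ltn_eqF.
  by rewrite !E hinv.
(* Either coordinate [k] exists and is flipped, or [trunc k.+1] and [trunc k] coincide. *)
have [[i [ik si]]|no] := pselect (exists i : 'I_d, i = k :> nat /\ s i).
  have E z : axis_isometry (trunc k.+1) c z =
      axis_isometry (trunc k) c (reflect_coord (widen_ord (leqnSn d) i) z).
    apply: pcoordP => j; rewrite !pcoord_mkpoint /trunc /signed_shift /= ltnS ik.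
    have [jk|jk] := eqVneq (j : nat) k; last by rewrite leq_eqVlt (negPf jk).
    have -> : j = i by apply: val_inj; rewrite /= ik jk.
    by rewrite ik leqnn ltnn si expr1 expr0 mulN1r mul1r.
  by rewrite !E IH reflect_inv.
suff -> : trunc k.+1 = trunc k by exact: IH.
apply/funext => j; rewrite /trunc ltnS leq_eqVlt.
have [jk|//] := eqVneq (j : nat) k.
suff /negPf -> : ~~ s j by [].
by apply/negP => sj; apply: no; exists j.
Qed.

(** * Evenness and support of the basis functions *)

Lemma reference_basis_prod (R : realType) (d : nat) (x : euclid R d) :
  reference_basis x =
  if [forall i, `|pcoord x i| <= 1] then \prod_(i < d) (1 - `|pcoord x i|) else 0.
Proof.
case: ifPn => [/forallP x1|].
  (* Adding 1 exactly at the negative coordinates moves [x] into the unit cube. *)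
  pose neg : multi_index (fun _ : 'I_d => 2%N) :=
    [ffun i => if pcoord x i < 0 then @Ordinal 2 1 isT else @Ordinal 2 0 isT].
  have cube : in_unit_cube (vadd (vertex R (mi_encode neg)) x).
    apply/forallP => i; have := x1 i.
    rewrite !pcoord_mkpoint /vertex_bit encodeK ffunE ler_norml.
    by case: ltrP => /= ? /andP[? ?]; apply/andP; split; lra.
  by rewrite (reference_basisE cube) element_basisE.
apply: contraNeq; rewrite /reference_basis; case: pickP => [k /forallP cube _|]; last first.
  by rewrite eqxx.
apply/forallP => i; have := cube i; rewrite !pcoord_mkpoint ler_norml.
have : (vertex_bit k i < 2)%N by exact: ltn_ord.
by case: (vertex_bit k i) => [|[|//]] _ /= /andP[? ?]; apply/andP; split; lra.
Qed.

Lemma reference_basis_norm (R : realType) (d : nat) (x y : euclid R d) :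
  (forall i, `|pcoord x i| = `|pcoord y i|) -> reference_basis x = reference_basis y.
Proof.
move=> xy; rewrite !reference_basis_prod.
under eq_forallb do rewrite xy.
by under eq_bigr do rewrite xy.
Qed.

(** The offset [c] cancels in the difference with the grid point; the remaining signs are invisible
    to an even function. *)
Lemma grid_basis_axis_isometry (R : realType) (d : nat) (a : euclid R d) (h : R)
    (L : 'I_d -> nat) (k l : 'I_(\prod_(i < d) L i)) (s : 'I_d -> bool) (c x : euclid R d) :
  grid_point a h k = axis_isometry s c (grid_point a h l) ->
  grid_basis a h k (axis_isometry s c x) = grid_basis a h l x.
Proof.
move=> kl; apply: reference_basis_norm => i.
rewrite kl !pcoord_mkpoint !normrM; congr (_ * _); rewrite /signed_shift.
by rewrite opprD addrACA subrr add0r -mulrBr normrM normr_sign mul1r.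
Qed.

Lemma grid_basis_support (R : realType) (d : nat) (a b : euclid R d) (h : R)
    (N : 'I_d -> nat) (k : 'I_(\prod_(i < d) (N i - 1))) (x : euclid R d) :
  0 < h -> (forall i, (pcoord b i - pcoord a i) / h = (N i)%:R) ->
  ~ closed_box a b x -> grid_basis a h k x = 0.
Proof.
move=> h0 hN; apply: contra_notP => /eqP; rewrite /grid_basis reference_basis_prod.
case: ifPn; last by rewrite eqxx.
move=> /forallP + _ i => /(_ i); rewrite !pcoord_mkpoint.
rewrite normrM gtr0_norm ?invr_gt0// mulrC ler_pdivrMr// mul1r ler_norml.
have ki := ltn_ord (mi_decode k i).
have bE : pcoord b i = pcoord a i + h * (N i)%:R by rewrite -hN mulrC divfK ?gt_eqF// subrKC.
have k0 : 0 <= h * (mi_decode k i)%:R by rewrite mulr_ge0// ltW.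
(* One step comes from the grid starting at a + h, the other from the support radius h; indices are
   at most [N i - 2]. *)
have : h * ((mi_decode k i)%:R + 2) <= h * (N i)%:R.
  by rewrite ler_pM2l// -natrD ler_nat; lia.
rewrite bE !mulrDr mulr1 => ? /andP[? ?]; apply/andP; split; lra.
Qed.

(** * Extension of the integrals to the whole space *)

Section energy_form.
Context (R : realType) (d : nat) (Omega : set (euclid R d)).
Variable gamma : euclid R d -> euclid R d -> R.
Hypothesis gamma_sym : forall x y, gamma x y = gamma y x.
Variables u v : euclid R d -> R.
Hypothesis u0 : forall x, ~ Omega x -> u x = 0.

Let D := Omega `|` interaction_domain Omega gamma.

Lemma kernel_eq0 x y : Omega x -> ~ D y -> gamma x y = 0.
Proof.
move=> Ox; apply: contra_notP => gxy.
by have [Oy|nOy] := pselect (Omega y); [left|right; split=> //; exists x].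
Qed.

(** If one point lies in [Omega], the other is outside [D] and the kernel vanishes; otherwise [u]
    vanishes at both. *)
Lemma energy_integrand_eq0 x y : ~ (D x /\ D y) ->
  (u y - u x) * (v y - v x) * gamma x y = 0.
Proof.
move=> nD; have [Ox|nOx] := pselect (Omega x).
  rewrite kernel_eq0 ?mulr0// => Dy; apply: nD; split=> //; by left.
have [Oy|nOy] := pselect (Omega y).
  rewrite gamma_sym kernel_eq0 ?mulr0// => Dx; apply: nD; split=> //; by left.
by rewrite !u0// subrr !mul0r.
Qed.

(** Once the domain is the whole space, a substitution need not map [D] to itself. *)
Lemma energy_form_setT :
  (\int[leb R d]_(x in D) \int[leb R d]_(y in D)
     ((u y - u x) * (v y - v x) * gamma x y)%:E =
   \int[leb R d]_x \int[leb R d]_y ((u y - u x) * (v y - v x) * gamma x y)%:E)%E.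
Proof.
rewrite integral_mkcond; apply: eq_integral => x _; rewrite patchE; case: ifPn => Dx.
  rewrite integral_mkcond; apply: eq_integral => y _; rewrite patchE; case: ifPn => // Dy.
  by rewrite energy_integrand_eq0// => -[_]; move: Dy; rewrite notin_setE.
rewrite integral0_eq// => y _; rewrite energy_integrand_eq0// => -[+ _].
by move: Dx; rewrite notin_setE.
Qed.

End energy_form.

(** * Toeplitz structure of the stiffness matrix *)

Theorem theorem3p1 (R : realType) (d : nat) (hd : (1 <= d)%N)
    (a b : euclid R d) (hab : forall i : 'I_d, pcoord a i < pcoord b i)
    (gamma : euclid R d -> euclid R d -> R)
    (hgamma : is_kernel (closed_box a b) gamma)
    (hinv : translation_reflection_invariant gamma)
    (h : R) (hh : 0 < h)
    (N : 'I_d -> nat) (hN : forall i : 'I_d, (2 <= N i)%N)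
    (hNh : forall i : 'I_d, (pcoord b i - pcoord a i) / h = (N i)%:R)
    (hV : fe_space a h (fun i => (N i - 1)%N) `<=` energy_space (closed_box a b) gamma) :
  multilevel_symmetric_toeplitz
    (stiffness (closed_box a b) gamma a h (fun i => (N i - 1)%N)).
Proof.
have [_ gamma_sym _ _] := hgamma.
have L0 i : (0 < N i - 1)%N by rewrite subn_gt0.
pose zero : multi_index (fun i => (N i - 1)%N) := [ffun i => Ordinal (L0 i)].
set A := stiffness _ _ _ _ _.
have AE k l : A k l = fine (\int[leb R d]_x \int[leb R d]_y
    ((grid_basis a h k y - grid_basis a h k x) *
     (grid_basis a h l y - grid_basis a h l x) * gamma x y)%:E)%E.
  by rewrite mxE energy_form_setT// => x; exact: grid_basis_support.
(* The case j = 0 forces this witness, as |m - 0| = m. *)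
clearbody A; exists (fun m => A (mi_encode m) (mi_encode zero)) => i j.
rewrite !AE; apply: (congr1 fine).
pose s m := (i m < j m)%N.
pose c : euclid R d := mkpoint (fun m =>
  pcoord a m + h * ((j m)%:R + 1) - (-1) ^+ s m * (pcoord a m + h)).
have gj : grid_point a h (mi_encode j) = axis_isometry s c (grid_point a h (mi_encode zero)).
  apply: pcoordP => m; rewrite !pcoord_mkpoint !encodeK /signed_shift !ffunE/= add0r mulr1.
  by rewrite subrK.
have gi : grid_point a h (mi_encode i) =
    axis_isometry s c (grid_point a h (mi_encode (absdiff i j))).
  apply: pcoordP => m; rewrite !pcoord_mkpoint !encodeK /signed_shift !ffunE/=.
  (* The sign is the one for which j_m plus or minus |i_m - j_m| equals i_m. *)
  rewrite /s; case: (ltnP (i m) (j m)) => ij.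
    have : (j m : nat) = (i m + `|(i m : int) - (j m : int)|)%N by lia.
    by move: `|_|%N => n ->; rewrite natrD expr1; ring.
  have : (i m : nat) = (j m + `|(i m : int) - (j m : int)|)%N by lia.
  by move: `|_|%N => n ->; rewrite natrD expr0; ring.
rewrite -(integral_axis_isometry s c); apply: eq_integral => x _.
rewrite -(integral_axis_isometry s c); apply: eq_integral => y _.
by rewrite gamma_axis_isometry// !(grid_basis_axis_isometry _ gi) !(grid_basis_axis_isometry _ gj).
Qed.
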